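(* Let $\mathcal{R}(\mathcal{F})$ be the Rees algebra of the filtration $\mathcal{F}=\{I_n\}_{n=0}^{\infty}$ associated to a covering polyhedron $\mathcal{Q}=\mathcal{Q}(C)$ and let $\mathcal{H}$ be the Hilbert basis of the Simis cone ${\rm SC}(\mathcal{Q})$. The following hold. (a) If $K[\mathbb{N}\mathcal{H}]$ is the semigroup ring of $\mathbb{N}\mathcal{H}$, then $\mathcal{R}(\mathcal{F})=K[\mathbb{N}\mathcal{H}]$. (b) $\mathcal{R}(\mathcal{F})$ is a Noetherian normal finitely generated $K$-algebra. (c) There exists an integer $p\geq 1$ such that $(I_p)^n=I_{np}$ for all $n\geq 1$.
   Context: $S=K[t_1,\ldots,t_s]$ is a polynomial ring over a field $K$, $\mathbb{N}=\{0,1,\ldots\}$, $t^a=t_1^{a_1}\cdots t_s^{a_s}$ for $a\in\mathbb{N}^s$; vector inequalities are componentwise and $1$ also denotes $(1,\ldots,1)$. $C$ is an $s\times m$ matrix with non-negative rational entries and non-zero columns $c_1,\ldots,c_m$; its covering polyhedron is $\mathcal{Q}(C)=\{x\in\mathbb{R}^s\mid x\geq 0;\ xC\geq 1\}$ ($x$ a row vector). The filtration associated to $\mathcal{Q}(C)$ is $I_0=S$ and, for $n\geq 1$, $I_n$ the ideal generated by all monomials $t^a$, $a\in\mathbb{N}^s$, with $a/n\in\mathcal{Q}(C)$. Its Rees algebra is $\mathcal{R}(\mathcal{F})=S\oplus I_1z\oplus\cdots\oplus I_nz^n\oplus\cdots\subset S[z]$, with $z$ a new variable. The Simis cone is ${\rm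 SC}(\mathcal{Q})=\{x\in\mathbb{R}^{s+1}\mid x\geq 0;\ \langle x,(c_i,-1)\rangle\geq 0\ \forall\, i\}$. The Hilbert basis $\mathcal{H}$ of ${\rm SC}(\mathcal{Q})$ is the set of all integral vectors $0\neq\alpha\in{\rm SC}(\mathcal{Q})$ such that $\alpha$ is not the sum of two other non-zero integral vectors in ${\rm SC}(\mathcal{Q})$; equivalently, it is the unique minimal finite set $\mathcal{H}\subset\mathbb{N}^{s+1}$ with ${\rm SC}(\mathcal{Q})=\mathbb{R}_+\mathcal{H}$ and $\mathbb{Z}^{s+1}\cap\mathbb{R}_+\mathcal{H}=\mathbb{N}\mathcal{H}$. Here $\mathbb{R}_+\mathcal{H}$ is the cone generated by $\mathcal{H}$, $\mathbb{N}\mathcal{H}$ is the additive subsemigroup of $\mathbb{N}^{s+1}$ (containing $0$) generated by $\mathcal{H}$, and $K[\mathbb{N}\mathcal{H}]=K[\{t^az^n\mid (a,n)\in\mathbb{N}\mathcal{H}\}]\subset S[z]$. *)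

(* Defs.v *)
From HB Require Import structures.
From mathcomp Require Import all_boot all_order all_algebra.
From mathcomp Require Import mpoly.
From mathcomp Require Import boolp classical_sets reals.

Set Implicit Arguments.
Unset Strict Implicit.
Unset Printing Implicit Defensive.

Import Order.TTheory GRing.Theory Num.Theory.

Local Open Scope classical_set_scope.
Local Open Scope ring_scope.

Section CommutativeAlgebra.

Definition is_ideal (A : comNzRingType) (I : set A) : Prop :=
  [/\ I 0, forall x y, I x -> I y -> I (x + y)
    & forall a x, I x -> I (a * x)].

Definition ideal_gen (A : comNzRingType) (X : set A) : set A :=
  smallest (@is_ideal A) X.

Definition ideal_mul (A : comNzRingType) (I J : set A) : set A :=
  ideal_gen [set z | exists x y, [/\ I x, J y & z = x * y]].

Fixpoint ideal_exp (A : comNzRingType) (I : set A) (n : nat) : set A :=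
  if n is k.+1 then ideal_mul I (ideal_exp I k) else setT.

Definition noetherian (A : comNzRingType) : Prop :=
  forall I : set A, is_ideal I -> exists xs : seq A, I = ideal_gen [set` xs].

Definition normal_domain (A : idomainType) : Prop :=
  forall u : {fraction A}, integralOver (@tofrac A) u -> exists a, u = tofrac a.

(* A K-algebra is given by its structure morphism.  Closure under opposite
   and under 1 follows from containing the image of K. *)
Definition is_subalgebra (K : fieldType) (A : comNzRingType)
    (iota : {rmorphism K -> A}) (B : set A) : Prop :=
  [/\ forall c, B (iota c), forall x y, B x -> B y -> B (x + y)
    & forall x y, B x -> B y -> B (x * y)].

Definition subalgebra_gen (K : fieldType) (A : comNzRingType)
    (iota : {rmorphism K -> A}) (X : set A) : set A :=
  smallest (is_subalgebra iota) X.

Definition finitely_generated_algebra (K : fieldType) (A : comNzRingType)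
    (iota : {rmorphism K -> A}) : Prop :=
  exists xs : seq A, subalgebra_gen iota [set` xs] = setT.

End CommutativeAlgebra.

Section Polyhedra.
Variables (R : realType) (s m : nat) (C : 'M[rat]_(s, m)).

Definition le_vec k (x y : 'rV[R]_k) : Prop := forall j, x 0 j <= y 0 j.

Definition dot k (x y : 'rV[R]_k) : R := \sum_j x 0 j * y 0 j.

Definition covering_polyhedron : set 'rV[R]_s :=
  [set x | le_vec 0 x /\ le_vec (const_mx 1) (x *m map_mx ratr C)].

Definition simis_cone : set 'rV[R]_(s + 1) :=
  [set x | le_vec 0 x /\
     forall i : 'I_m,
       0 <= dot x (row_mx (map_mx ratr (col i C)^T) (const_mx (-1)))].

Definition integral_simis_cone : set 'rV[int]_(s + 1) :=
  [set a | simis_cone (map_mx intr a)].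

(* The summands b and c are automatically different from a, both being
   non-zero. *)
Definition hilbert_basis : set 'rV[int]_(s + 1) :=
  [set a | [/\ integral_simis_cone a, a != 0
    & ~ exists b c : 'rV[int]_(s + 1),
          [/\ integral_simis_cone b, b != 0, integral_simis_cone c, c != 0
            & a = b + c]]].

End Polyhedra.

Definition nat_span (V : zmodType) (X : set V) : set V :=
  smallest [set M | M 0 /\ forall x y, M x -> M y -> M (x + y)] X.

Definition monomial_exponent s (a : 'X_{1.. s}) (n : nat) : 'rV[int]_(s + 1) :=
  row_mx (\row_i (a i)%:Z) (const_mx n%:Z).

Section Rees.
Variables (R : realType) (K : fieldType) (s m : nat) (C : 'M[rat]_(s, m)).

Notation Sz := {poly {mpoly K[s]}}.

Definition scalar : {rmorphism K -> Sz} := polyC \o @mpolyC s K.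

Definition semigroup_ring (M : set 'rV[int]_(s + 1)) : set Sz :=
  subalgebra_gen scalar
    [set f | exists (a : 'X_{1.. s}) (n : nat),
       M (monomial_exponent a n) /\ f = 'X_[a]%:P * 'X^n].

Definition filtration (n : nat) : set {mpoly K[s]} :=
  if n is 0 then setT else
  ideal_gen [set f | exists2 a : 'X_{1.. s},
    covering_polyhedron C (\row_i ((a i)%:R / n%:R) : 'rV[R]_s) & f = 'X_[a]].

Definition rees : set Sz := [set f | forall n, filtration n f`_n].

Lemma filtration_ideal n : is_ideal (filtration n).
Proof.
case: n => [|n]; first by split.
split.
- by move=> B [[]].
- move=> x y Ix Iy B XB; have [[_ BD _] _] := XB.
  by apply: BD; [exact: Ix XB|exact: Iy XB].
- move=> a x Ix B XB; have [[_ _ BM] _] := XB.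
  by apply: BM; exact: Ix XB.
Qed.

Lemma filtrationM i j x y :
  filtration i x -> filtration j y -> filtration (i + j) (x * y).
Proof.
case: i => [|i] Ix Iy; first by have [_ _] := filtration_ideal j; apply.
case: j Iy => [|j] Iy.
  by rewrite addn0 mulrC; have [_ _] := filtration_ideal i.+1; apply.
have [I0 ID IM] := filtration_ideal (i.+1 + j.+1).
apply: (Ix [set x | filtration (i.+1 + j.+1) (x * y)]); split.
  split=> [|u v|a u] /=; first by rewrite mul0r.
    by rewrite mulrDl; apply: ID.
  by rewrite -mulrA; apply: IM.
move=> _ [a [a0 Ca] ->] /=.
apply: (Iy [set y | filtration (i.+1 + j.+1) ('X_[a] * y)]); split.
  split=> [|u v|b u] /=; first by rewrite mulr0.
    by rewrite mulrDr; apply: ID.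
  by rewrite mulrCA; apply: IM.
move=> _ [b [b0 Cb] ->] /= B [_]; apply; exists (a + b)%MM; last first.
  by rewrite mpolyXD.
have ni : (i.+1%:R : R) != 0 by rewrite pnatr_eq0.
have nj : (j.+1%:R : R) != 0 by rewrite pnatr_eq0.
have nij : ((i.+1 + j.+1)%:R : R) != 0 by rewrite pnatr_eq0.
have cancel (n z c : R) : n != 0 -> n * (z / n * c) = z * c.
  by move=> n0; rewrite mulrA (mulrC n) divfK.
split; first by move=> k; rewrite !mxE divr_ge0 ?ler0n.
move=> l; have := Ca l; have := Cb l; rewrite !mxE => Cbl Cal.
have := lerD (ler_wpM2l (ler0n R i.+1) Cal) (ler_wpM2l (ler0n R j.+1) Cbl).
rewrite !mulr1 -natrD -[X in X <= _]mulr1 => /le_trans le1.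
rewrite -(ler_pM2l (_ : 0 < (i.+1 + j.+1)%:R)) ?ltr0n //; apply: le1.
rewrite !mulr_sumr -big_split /=; apply: ler_sum => k _.
by rewrite !mxE mnmDE !cancel // (natrD _ (a k)) mulrDl.
Qed.

Definition rees_pred : {pred Sz} := fun f => `[< rees f >].

Lemma rees_predP f : reflect (rees f) (f \in rees_pred).
Proof. exact: asboolP. Qed.

Lemma scalar_rees c : scalar c \in rees_pred.
Proof.
apply/rees_predP => -[|n] //; rewrite /= coefC /=.
by have [] := filtration_ideal n.+1.
Qed.

Lemma rees_subring_closed : subring_closed rees_pred.
Proof.
split=> [|f g /rees_predP fR /rees_predP gR|f g /rees_predP fR /rees_predP gR].
- by rewrite -[1](rmorph1 scalar) scalar_rees.
- apply/rees_predP => n; have [_ ID IM] := filtration_ideal n.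
  by rewrite coefB -mulN1r; apply: ID; [apply: fR|apply: IM; apply: gR].
- apply/rees_predP => n; have [I0 ID IM] := filtration_ideal n.
  rewrite coefM; apply: (big_ind (filtration n)) => // i _.
  have := filtrationM (fR i) (gR (n - i)%N).
  by rewrite subnKC // -ltnS.
Qed.

HB.instance Definition _ :=
  GRing.isSubringClosed.Build Sz rees_pred rees_subring_closed.

Record rees_algebra := ReesAlgebra {
  rees_val :> Sz;
  rees_valP : rees_val \in rees_pred }.

HB.instance Definition _ := [isSub for rees_val].
HB.instance Definition _ := [Choice of rees_algebra by <:].
HB.instance Definition _ := [SubChoice_isSubComNzRing of rees_algebra by <:].

(* Units and inverses are irrelevant to the mathematics; they are supplied
   classically only because idomainType requires them. *)
Definition rees_unit : pred rees_algebra :=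
  fun x => `[< exists y, y * x = 1 >].

Definition rees_inv (x : rees_algebra) : rees_algebra :=
  if pselect (exists y, y * x = 1) is left e then projT1 (cid e) else x.

Lemma rees_mulVx : {in rees_unit, left_inverse 1 rees_inv *%R}.
Proof.
move=> x /asboolP e; rewrite /rees_inv; case: pselect => // e'.
by case: (cid e').
Qed.

Lemma rees_unitPl x y : y * x = 1 -> rees_unit x.
Proof. by move=> yx; apply/asboolP; exists y. Qed.

Lemma rees_inv_out : {in [predC rees_unit], rees_inv =1 id}.
Proof.
move=> x xNu; rewrite /rees_inv; case: pselect => // e.
by move: xNu; rewrite inE => /negP[]; apply/asboolP.
Qed.

HB.instance Definition _ := GRing.ComNzRing_hasMulInverse.Build rees_algebra
  rees_mulVx rees_unitPl rees_inv_out.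

Lemma rees_mulf_eq0 (x y : rees_algebra) :
  x * y = 0 -> (x == 0) || (y == 0).
Proof.
by move=> /(congr1 val)/eqP; rewrite rmorphM rmorph0 mulf_eq0 -!val_eqE.
Qed.

HB.instance Definition _ :=
  GRing.ComUnitRing_isIntegral.Build rees_algebra rees_mulf_eq0.

Definition rees_scalar (c : K) : rees_algebra := ReesAlgebra (scalar_rees c).

Lemma rees_scalar_zmod_morphism : zmod_morphism rees_scalar.
Proof. by move=> c d; apply/val_inj; exact: (rmorphB scalar). Qed.

Lemma rees_scalar_monoid_morphism : monoid_morphism rees_scalar.
Proof.
by split=> [|c d]; apply/val_inj;
  [exact: (rmorph1 scalar)|exact: (rmorphM scalar)].
Qed.

HB.instance Definition _ := GRing.isZmodMorphism.Build K rees_algebra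
  rees_scalar rees_scalar_zmod_morphism.
HB.instance Definition _ := GRing.isMonoidMorphism.Build K rees_algebra
  rees_scalar rees_scalar_monoid_morphism.

End Rees.

Arguments filtration R K {s m} C n.
Arguments rees R K {s m} C.
Arguments rees_algebra R K {s m} C.
Arguments rees_scalar R K {s m} C.
Arguments semigroup_ring K {s} M.
Arguments covering_polyhedron R {s m} C.
Arguments simis_cone R {s m} C.
Arguments hilbert_basis R {s m} C.

(* Main.v *)
Require Import Defs.
From HB Require Import structures.
From mathcomp Require Import all_boot all_order all_algebra.
From mathcomp Require Import mpoly.
From mathcomp Require Import boolp classical_sets reals.
From mathcomp Require Import zify.

Import Order.TTheory GRing.Theory Num.Theory.

Local Open Scope classical_set_scope.
Local Open Scope ring_scope.

(** The exponents of the monomials [t^a z^n] that lie in the Rees algebra are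
    the integral points of the Simis cone.  After multiplying the inequalities
    of the cone by a common denominator [D] of the entries of the matrix, this
    set of exponents becomes the submonoid [in_monoid D N] of [N^s * N] cut out
    by inequalities between natural numbers.  As every [I_n] is a monomial
    ideal, a polynomial belongs to the Rees algebra if and only if all its
    monomials have exponents in this monoid ([filtrationP], [rees_term_sum]).
    The whole theorem is then about this monoid.

    The main tool is that divisibility of monomials inside the Rees algebra is
    the componentwise order of [N^(s + 1 + m)], once to an exponent are added
    its slacks in the [m] defining inequalities ([coordinates_le]).  Dickson's
    lemma therefore applies to any set of exponents ([dickson_monoid]).

    - Minimal nonzero exponents are finitely many and generate the monoid, so
      the algebra is finitely generated.  That the Hilbert basis generates the
      monoid is a separate and easier induction on the total degree
      ([nat_span_hilbert_basis]), which gives equality with the semigroup ring.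

    - Choosing a monomial order and dividing leading terms within the monoid,
      the Rees algebra has its own division algorithm ([rees_divide]).  Applied
      to an ideal, with Dickson's lemma for the leading exponents, it shows
      that the algebra is Noetherian, without a detour through Hilbert's basis
      theorem and a presentation of the algebra.

    - The same division gives normality.  An element [p / q] integral over a
      domain satisfies [q^n | d p^n] for all [n], for some fixed nonzero [d].
      Comparing leading exponents, [n (lm p - lm q) + lm d] is in the cone for
      all [n], and a closed cone then contains [lm p - lm q]: so the leading
      term of [q] divides that of [p] in the Rees algebra, and replacing [p] by
      [p - t q] preserves the hypothesis.  By induction [q] divides [p].

    - For the Veronese property, let [L] be a common multiple of the positive
      degrees of the generators of the monoid and [r] larger than their number.
      By the pigeonhole principle every exponent of degree at least [r L] has a
      summand of degree exactly [L].  Removing [r] such summands shows that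
      an exponent of degree [(n + 1) r L] splits off one of degree [r L]
      ([veronese_split]), and [p := r L] works. *)

(** * Dickson's lemma *)

(** The induction on the number of coordinates sets the first one apart.  A
    finite set [xs] that dominates on the other coordinates is enough for those
    [x] whose first coordinate is at least the maximum of that of [xs]; what
    remains is a union of finitely many slices on which the first coordinate is
    constant.  The map [phi] lets the lemma produce elements of [T] (ring
    elements, say) rather than vectors of numbers. *)
Lemma dickson (T : eqType) (k : nat) (phi : T -> 'I_k -> nat) (X : set T) :
  exists xs : seq T, (forall y, y \in xs -> X y) /\
    forall x, X x -> exists2 y, y \in xs & forall i, (phi y i <= phi x i)%N.
Proof.
elim: k phi X => [|k IHk] phi X.
  have [[x Xx]|noX] := pselect (exists x, X x).
    exists [:: x]; split=> [y|x' _]; first by rewrite inE => /eqP->.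
    by exists x; rewrite ?inE// => -[].
  by exists [::]; split=> // x Xx; case: noX; exists x.
pose psi x (i : 'I_k) := phi x (lift ord0 i).
have slices n : exists xs : seq T, (forall y, y \in xs -> X y) /\
    forall x, X x -> (phi x ord0 < n)%N ->
      exists2 y, y \in xs & forall i, (phi y i <= phi x i)%N.
  elim: n => [|n [xs [xsX xsP]]]; first by exists [::].
  have [ys [ysX ysP]] := IHk psi [set x | X x /\ phi x ord0 = n].
  exists (xs ++ ys); split=> [y|x Xx].
    by rewrite mem_cat => /orP[/xsX //|/ysX[]].
  rewrite ltnS leq_eqVlt => /orP[/eqP xn|/(xsP x Xx)[y yxs le_yx]]; last first.
    by exists y => //; rewrite mem_cat yxs.
  have [y yys le_yx] := ysP x (conj Xx xn).
  exists y => [|i]; first by rewrite mem_cat yys orbT.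
  case: (unliftP ord0 i) => [j|] ->; first exact: le_yx.
  by rewrite xn; have [_ ->] := ysX y yys.
have [xs [xsX xsP]] := IHk psi X.
have [ys [ysX ysP]] := slices (\max_(x <- xs) phi x ord0)%N.
exists (xs ++ ys); split=> [y|x Xx].
  by rewrite mem_cat => /orP[/xsX|/ysX].
have [ltx|lex] := ltnP (phi x ord0) (\max_(x <- xs) phi x ord0)%N.
  by have [y yys le_yx] := ysP x Xx ltx; exists y; rewrite // mem_cat yys orbT.
have [y yxs le_yx] := xsP x Xx; exists y => [|i]; first by rewrite mem_cat yxs.
case: (unliftP ord0 i) => [j|] ->; first exact: le_yx.
by apply: leq_trans lex; apply: (leq_bigmax_seq (F := phi^~ ord0)).
Qed.

(** The archimedean argument behind the closedness of the cone. *)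
Lemma leq_asymptotic (a b d : nat) :
  (forall n, (n * b <= d + n * a)%N) -> (b <= a)%N.
Proof.
move=> le_n; rewrite leqNgt; apply/negP => lt_ab.
by have := le_n d.+1; nia.
Qed.

(** * The monoid of exponents of the Rees algebra *)

Section ExponentMonoid.
Variables (s m : nat) (D : nat) (N : 'M[nat]_(s, m)).
Implicit Types (a b c : 'X_{1..s}) (n k : nat).

Definition col_weight a j : nat := (\sum_i a i * N i j)%N.

Definition in_monoid a n : Prop := forall j, (D * n <= col_weight a j)%N.

Lemma col_weightD a b j :
  col_weight (a + b)%MM j = (col_weight a j + col_weight b j)%N.
Proof.
by rewrite /col_weight -big_split; apply: eq_bigr => i _; rewrite mnmDE mulnDl.
Qed.

Lemma in_monoidD a b n k :
  in_monoid a n -> in_monoid b k -> in_monoid (a + b)%MM (n + k).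
Proof. by move=> Ma Mb j; rewrite mulnDr col_weightD leq_add. Qed.

Lemma in_monoid0 a : in_monoid a 0.
Proof. by move=> j; rewrite muln0. Qed.

Lemma in_monoidMn a n t : in_monoid a n -> in_monoid (a *+ t)%MM (n * t).
Proof.
move=> Ma; elim: t => [|t IHt]; first by rewrite muln0; apply: in_monoid0.
by rewrite mulmS mulnS; apply: in_monoidD.
Qed.

(** The exponent, followed by its slacks in the inequalities of [in_monoid]:
    these are the coordinates that turn the order of the monoid into the
    componentwise order.  The truncated subtraction is exact on the monoid. *)
Definition coordinates (x : 'X_{1..s} * nat) (i : 'I_(s + (1 + m))) : nat :=
  match split i with
  | inl i => x.1 i
  | inr i => match split i with
             | inl _ => x.2
             | inr j => (col_weight x.1 j - D * x.2)%N
             end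
  end.

(** A difference of two exponents is again in the monoid as soon as no slack
    decreases, since slacks are additive. *)
Lemma coordinates_le x y : in_monoid x.1 x.2 -> in_monoid y.1 y.2 ->
  (forall i, (coordinates y i <= coordinates x i)%N) ->
  exists b k, [/\ in_monoid b k, x.1 = (y.1 + b)%MM & x.2 = (y.2 + k)%N].
Proof.
move=> Mx My le_yx.
have le1 i : (y.1 i <= x.1 i)%N.
  by have := le_yx (unsplit (inl i)); rewrite /coordinates unsplitK.
have le2 : (y.2 <= x.2)%N.
  have := le_yx (unsplit (inr (unsplit (inl ord0)))).
  by rewrite /coordinates !unsplitK.
have def1 : x.1 = (y.1 + (x.1 - y.1))%MM.
  by apply/mnmP => i; rewrite mnmDE mnmBE subnKC.
exists (x.1 - y.1)%MM, (x.2 - y.2)%N; split=> // [j|]; last by rewrite subnKC.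
have := le_yx (unsplit (inr (unsplit (inr j)))).
rewrite /coordinates !unsplitK; have := My j; have := Mx j.
by have /= := congr1 (col_weight^~ j) def1; rewrite col_weightD; nia.
Qed.

Lemma dickson_monoid (T : eqType) (e : T -> 'X_{1..s} * nat) (X : set T) :
  (forall x, X x -> in_monoid (e x).1 (e x).2) ->
  exists xs : seq T, (forall y, y \in xs -> X y) /\
    forall x, X x -> exists y b k, [/\ y \in xs, in_monoid b k,
      (e x).1 = ((e y).1 + b)%MM & (e x).2 = ((e y).2 + k)%N].
Proof.
move=> XM; have [xs [xsX xsP]] := @dickson _ _ (coordinates \o e) X.
exists xs; split=> // x Xx; have [y yxs le_yx] := xsP x Xx.
have [b [k [Mb def1 def2]]] :=
  coordinates_le (e x) (e y) (XM _ Xx) (XM _ (xsX _ yxs)) le_yx.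
by exists y, b, k.
Qed.

(** If [d + n (p - q)] is in the monoid for all [n], then so is [p - q]: each
    defining inequality is linear, and a negative value on [p - q] would
    outweigh the fixed contribution of [d] for large [n].  To stay in natural
    numbers, [e = d + n (p - q)] is written [d + n p = n q + e]. *)
Lemma in_monoid_asymptotic (d p q : 'X_{1..s} * nat) :
  (forall n, exists b k, [/\ in_monoid b k,
     (d.1 + p.1 *+ n = q.1 *+ n + b)%MM & (d.2 + n * p.2 = n * q.2 + k)%N]) ->
  exists b k, [/\ in_monoid b k, p.1 = (q.1 + b)%MM & p.2 = (q.2 + k)%N].
Proof.
move=> Hn.
have wn a n j : col_weight (a *+ n)%MM j = (n * col_weight a j)%N.
  elim: n => [|n IHn]; last by rewrite mulmS col_weightD IHn mulSn.
  by rewrite mul0n /col_weight big1// => i _; rewrite mulm0n mnm0E.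
have le1 i : (q.1 i <= p.1 i)%N.
  apply: (@leq_asymptotic _ _ (d.1 i)) => n; have [b [k [_ + _]]] := Hn n.
  by move=> /(congr1 (fun a : 'X_{1..s} => a i)); rewrite !mnmDE !mulmnE; nia.
have le2 : (q.2 <= p.2)%N.
  by apply: (@leq_asymptotic _ _ d.2) => n; have [b [k [_ _]]] := Hn n; nia.
have def1 : p.1 = (q.1 + (p.1 - q.1))%MM.
  by apply/mnmP => i; rewrite mnmDE mnmBE subnKC.
exists (p.1 - q.1)%MM, (p.2 - q.2)%N; split=> // [j|]; last by rewrite subnKC.
suff : (D * p.2 + col_weight q.1 j <= D * q.2 + col_weight p.1 j)%N.
  by have /= := congr1 (col_weight^~ j) def1; rewrite col_weightD; nia.
apply: (@leq_asymptotic _ _ (col_weight d.1 j)) => n.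
have [b [k [/(_ j) Mb + def2]]] := Hn n.
move=> /(congr1 (col_weight^~ j)); rewrite !col_weightD !wn; nia.
Qed.

(** Linear combinations of [hs], with the multiplicity [t] of each generator
    visible; the pigeonhole argument of [nat_comb_split] is about it. *)
Fixpoint nat_comb (hs : seq ('X_{1..s} * nat)) a n : Prop :=
  if hs is h :: hs' then exists t b k,
    [/\ nat_comb hs' b k, a = (h.1 *+ t + b)%MM & n = (h.2 * t + k)%N]
  else a = 0%MM /\ n = 0%N.

Lemma nat_comb0 hs : nat_comb hs 0%MM 0%N.
Proof.
elim: hs => //= h hs IHhs; exists 0%N, 0%MM, 0%N; split=> //.
  by rewrite mulm0n add0m.
by rewrite muln0.
Qed.

Lemma nat_comb_add hs h a n : h \in hs -> nat_comb hs a n ->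
  nat_comb hs (h.1 + a)%MM (h.2 + n)%N.
Proof.
elim: hs a n => //= h' hs IHhs a n; rewrite inE => hh' [t [b [k [cb -> ->]]]].
have [->|nhh'] := eqVneq h h'.
  exists t.+1, b, k; split=> //; first by rewrite mulmS addmA.
  by rewrite mulnS addnA.
move: hh'; rewrite (negPf nhh') /= => hhs.
exists t, (h.1 + b)%MM, (h.2 + k)%N; split; first exact: IHhs.
  by rewrite !addmA (addmC h.1).
by rewrite addnCA.
Qed.

Lemma nat_comb_ind hs (P : 'X_{1..s} -> nat -> Prop) : P 0%MM 0%N ->
  (forall h a n, h \in hs -> P a n -> P (h.1 + a)%MM (h.2 + n)%N) ->
  forall a n, nat_comb hs a n -> P a n.
Proof.
move=> P0; elim: hs => [|h hs IHhs] PD a n /=; first by move=> [-> ->].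
move=> [t [b [k [cb -> ->]]]].
have Pb : P b k.
  by apply: IHhs cb => h' a' n' h'hs; apply: PD; rewrite inE h'hs orbT.
elim: t => [|t IHt]; first by rewrite mulm0n add0m muln0.
by rewrite mulmS mulnS -addmA -addnA; apply: PD; rewrite ?mem_head.
Qed.

Lemma nat_comb_in_monoid hs a n : (forall h, h \in hs -> in_monoid h.1 h.2) ->
  nat_comb hs a n -> in_monoid a n.
Proof.
move=> Mhs; apply: nat_comb_ind => [|h b k hhs]; first exact: in_monoid0.
by apply: in_monoidD; apply: Mhs.
Qed.

(** Generators are the minimal nonzero exponents: each nonzero exponent is such
    a generator plus an exponent of smaller total degree. *)
Lemma monoid_finitely_generated : exists hs : seq ('X_{1..s} * nat),
  (forall h, h \in hs -> in_monoid h.1 h.2) /\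
  forall a n, in_monoid a n -> nat_comb hs a n.
Proof.
have [hs [hsX hsP]] := @dickson_monoid _ id
  [set x | in_monoid x.1 x.2 /\ (0 < mdeg x.1 + x.2)%N] (fun x Xx => proj1 Xx).
exists hs; split=> [h /hsX[]//|a n].
have [w] := ubnP (mdeg a + n); elim: w a n => // w IHw a n le_w Ma.
have [|] := posnP (mdeg a + n).
  move/eqP; rewrite addn_eq0 mdeg_eq0 => /andP[/eqP-> /eqP->].
  exact: nat_comb0.
move=> an_gt0.
have [y [b [k [yhs Mb /= defa defn]]]] := hsP (a, n) (conj Ma an_gt0).
rewrite defa defn; apply: nat_comb_add => //; apply: IHw => //.
by move: le_w; rewrite defa defn mdegD; have [_ /=] := hsX y yhs; lia.
Qed.

(** Pigeonhole: if the total degree exceeds [size hs * L], some generator [h]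
    contributes at least [L] to it, and [L / deg h] copies of [h] form the
    summand of degree [L]. *)
Lemma nat_comb_split (L : nat) hs a n :
  (forall h, h \in hs -> in_monoid h.1 h.2) ->
  (forall h, h \in hs -> (0 < h.2)%N -> (h.2 %| L)%N) ->
  nat_comb hs a n -> (size hs * L < n)%N ->
  exists b c k,
    [/\ in_monoid b L, in_monoid c k, a = (b + c)%MM & n = (L + k)%N].
Proof.
elim: hs a n => [|h hs IHhs] a n /= Mhs dvL; first by move=> [_ ->].
have Mhs' h' : h' \in hs -> in_monoid h'.1 h'.2.
  by move=> h'hs; apply: Mhs; rewrite inE h'hs orbT.
have dvL' h' : h' \in hs -> (0 < h'.2)%N -> (h'.2 %| L)%N.
  by move=> h'hs; apply: dvL; rewrite inE h'hs orbT.
move=> [t [b [k [cb -> ->]]]] lt_n.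
have [lt_L|le_L] := ltnP (h.2 * t) L; last first.
  (* Here [h] contributes at least L; if its degree is 0 then L = 0. *)
  have [h0|h_gt0] := posnP h.2.
    have L0 : L = 0%N by move: le_L; rewrite h0; lia.
    exists 0%MM, (h.1 *+ t + b)%MM, (h.2 * t + k)%N.
    split; rewrite ?add0m ?L0//; first exact: in_monoid0.
    apply: in_monoidD; first by apply: in_monoidMn; apply: Mhs; rewrite mem_head.
    exact: nat_comb_in_monoid cb.
  have defL : L = (h.2 * (L %/ h.2))%N.
    by rewrite mulnC divnK// dvL ?mem_head.
  have Mh : in_monoid h.1 h.2 by apply: Mhs; rewrite mem_head.
  have le_t : (L %/ h.2 <= t)%N by rewrite -(leq_pmul2l h_gt0) -defL.
  exists (h.1 *+ (L %/ h.2))%MM, (h.1 *+ (t - L %/ h.2) + b)%MM,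
    (h.2 * (t - L %/ h.2) + k)%N; split.
  - by rewrite {2}defL; apply: in_monoidMn.
  - by apply: in_monoidD; [apply: in_monoidMn|apply: nat_comb_in_monoid cb].
  - by rewrite addmA; congr (_ + _)%MM; apply/mnmP => i;
      rewrite mnmDE !mulmnE -mulnDr subnKC.
  - by rewrite addnA [X in (X + _ + k)%N]defL -mulnDr subnKC.
have [|b1 [c [l [Mb1 Mc -> ->]]]] := IHhs b k Mhs' dvL' cb.
  by rewrite -(ltn_add2l L); apply: leq_trans lt_n _; rewrite leq_add2r ltnW.
exists b1, (h.1 *+ t + c)%MM, (h.2 * t + l)%N; split=> //.
- by apply: in_monoidD => //; apply: in_monoidMn; apply: Mhs; rewrite mem_head.
- by rewrite !addmA (addmC b1).
- by rewrite addnCA.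
Qed.

(** A summand of degree [L] can be removed as long as the degree left exceeds
    [size hs * L].  Starting from a degree at least [2 r L], where
    [r = size hs + 1], this can be done [r] times. *)
Lemma veronese_split : exists p, (0 < p)%N /\ forall a n,
  in_monoid a (n.+1 * p) ->
  exists b c, [/\ in_monoid b p, in_monoid c (n * p) & a = (b + c)%MM].
Proof.
have [hs [Mhs hsP]] := monoid_finitely_generated.
(* The factorial of the largest degree is a common multiple of the degrees. *)
pose L := (\max_(h <- hs) h.2)`!%N.
have L_gt0 : (0 < L)%N by rewrite fact_gt0.
have dvL h : h \in hs -> (0 < h.2)%N -> (h.2 %| L)%N.
  move=> hhs h_gt0; apply: dvdn_fact; rewrite h_gt0 /=.
  exact: (leq_bigmax_seq (F := snd)).
pose r := (size hs).+1; exists (r * L)%N.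
split=> [|a n Ma]; first by rewrite muln_gt0.
case: n Ma => [|n] Ma.
  exists a, 0%MM; rewrite addm0 -[X in in_monoid a X]mul1n.
  by split => //; apply: in_monoid0.
suff step j : (j <= r)%N -> exists b c, [/\ in_monoid b (j * L),
    in_monoid c (n.+2 * (r * L) - j * L) & a = (b + c)%MM].
  have [b [c [Mb Mc ->]]] := step r (leqnn _).
  exists b, c; split=> //.
  by rewrite (_ : (_ * _ = n.+2 * (r * L) - r * L)%N)//; lia.
elim: j => [_|j IHj lt_jr].
  by exists 0%MM, a; rewrite add0m mul0n subn0; split => //; apply: in_monoid0.
have [b [c [Mb Mc ->]]] := IHj (ltnW lt_jr).
have [|b' [c' [k [Mb' Mc' -> defk]]]] :=
    nat_comb_split L hs _ _ Mhs dvL (hsP _ _ Mc).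
  rewrite mulnA -mulnBl ltn_pmul2r// -[(size hs).+1]/r !mulSn.
  by move: lt_jr; lia.
exists (b + b')%MM, c'; split; last by rewrite addmA.
  by rewrite mulSn addnC; apply: in_monoidD.
by rewrite (_ : (_ - _ = k)%N)//; lia.
Qed.

End ExponentMonoid.

Arguments col_weight {s m} N a j.
Arguments in_monoid {s m} D N a n.
Arguments nat_comb {s} hs a n.

(** * Leading terms *)

Section LeadingTerms.
Variables (K : fieldType) (s : nat).
Local Notation Sz := {poly {mpoly K[s]}}.
Implicit Types (f g : Sz) (a b : 'X_{1..s}) (n k : nat) (c : K).

(** A scalar times a generator in the form of [semigroup_ring], so that
    membership in a subalgebra follows by a single product. *)
Definition term c a n : Sz := Defs.scalar K s c * ('X_[a]%:P * 'X^n).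

Definition lead_mon f : 'X_{1..s} := mlead (lead_coef f).
Definition lead_scal f : K := mleadc (lead_coef f).

(** Terms are ordered first by the degree in [z], then by the monomial order
    in [t].  The size is compared rather than the degree, so that 0 comes before
    all nonzero polynomials. *)
Definition lead_lt g f : bool :=
  (size g < size f)%N || (size g == size f) && (lead_mon g < lead_mon f)%O.

Lemma lead_ind (P : Sz -> Prop) :
  (forall f, (forall g, lead_lt g f -> P g) -> P f) -> forall f, P f.
Proof.
move=> IH f; have [w] := ubnP (size f); elim: w f => // w IHw f.
have [a] : exists a, lead_mon f = a by exists (lead_mon f).
elim/(@ltmwf s): a f => a IHa f defa le_w.
apply: IH => g /orP[lt_gf|/andP[/eqP eq_gf lt_gf]].
  by apply: IHw; apply: leq_trans lt_gf _.
by apply: (IHa (lead_mon g)); rewrite -?defa ?eq_gf.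
Qed.

Lemma lead_scal_eq0 f : (lead_scal f == 0) = (f == 0).
Proof. by rewrite mleadc_eq0 lead_coef_eq0. Qed.

Lemma lead_cancel f g : f != 0 -> size g = size f ->
  lead_mon g = lead_mon f -> lead_scal g = lead_scal f -> lead_lt (f - g) f.
Proof.
move=> f0 eq_sz eq_mon eq_scal; rewrite /lead_lt.
have : (size (f - g)%R <= size f)%N.
  by rewrite (leq_trans (size_polyD _ _))// size_polyN eq_sz maxnn.
rewrite leq_eqVlt => /orP[/eqP szfg|->//].
rewrite szfg eqxx ltnn /= /lead_mon /lead_coef szfg coefB.
have nz : (f - g)`_(size f).-1 != 0.
  rewrite -szfg -lead_coefE lead_coef_eq0 -size_poly_gt0 szfg size_poly_gt0.
  exact: f0.
move: nz eq_mon eq_scal; rewrite /lead_mon /lead_scal /lead_coef eq_sz coefB.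
set p := f`_(size f).-1; set q := g`_(size f).-1 => pq0 eq_mon eq_scal.
rewrite lt_neqAle; apply/andP; split; last first.
  by apply: le_trans (mleadB_le _ _) _; rewrite eq_mon joinxx.
apply/eqP => eq_pq; move: pq0; rewrite -mleadc_eq0 eq_pq mcoeffB.
by rewrite -{2}eq_mon eq_scal subrr eqxx.
Qed.

Lemma termE c a n : term c a n = (c *: 'X_[a])%:P * 'X^n.
Proof. by rewrite /term mulrA -polyCM /= mul_mpolyC. Qed.

Lemma coef_term c a n k : (term c a n)`_k = if k == n then c *: 'X_[a] else 0.
Proof.
by rewrite termE coefCM coefXn; case: eqP; rewrite ?mulr1 ?mulr0.
Qed.

Lemma lead_coef_term c a n : lead_coef (term c a n) = c *: 'X_[a].
Proof. by rewrite termE lead_coefM lead_coefC lead_coefXn mulr1. Qed.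

Lemma termX_neq0 c a : c != 0 -> c *: 'X_[a] != 0 :> {mpoly K[s]}.
Proof.
by move=> c0; rewrite -mleadc_eq0 mleadZ// mleadXm mcoeffZ mcoeffX eqxx mulr1.
Qed.

Lemma size_term c a n : c != 0 -> size (term c a n) = n.+1.
Proof.
move=> c0; rewrite termE size_mul ?polyC_eq0 ?termX_neq0//; last first.
  by rewrite -size_poly_eq0 size_polyXn.
by rewrite size_polyC termX_neq0// size_polyXn.
Qed.

Lemma lead_mon_term c a n : c != 0 -> lead_mon (term c a n) = a.
Proof. by move=> c0; rewrite /lead_mon lead_coef_term mleadZ// mleadXm. Qed.

Lemma lead_scal_term c a n : lead_scal (term c a n) = c.
Proof.
have [->|c0] := eqVneq c 0.
  by rewrite /lead_scal lead_coef_term scale0r mleadc0.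
rewrite /lead_scal lead_coef_term mleadZ// mleadXm.
by rewrite mcoeffZ mcoeffX eqxx mulr1.
Qed.

Lemma lead_monM f g : f != 0 -> g != 0 ->
  lead_mon (f * g) = (lead_mon f + lead_mon g)%MM.
Proof.
by move=> f0 g0; rewrite /lead_mon lead_coefM mleadM ?lead_coef_eq0.
Qed.

Lemma lead_scalM f g : f != 0 -> g != 0 ->
  lead_scal (f * g) = lead_scal f * lead_scal g.
Proof.
move=> f0 g0; rewrite /lead_scal lead_coefM mleadM ?lead_coef_eq0//.
exact: mleadcM.
Qed.

Lemma deg_mul f g : f != 0 -> g != 0 ->
  (size (f * g)).-1 = ((size f).-1 + (size g).-1)%N.
Proof.
move=> f0 g0; rewrite size_mul//.
move: f0 g0; rewrite -!size_poly_gt0.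
by case: (size f) (size g) => [|u] [|v] //= _ _; rewrite addnS.
Qed.

Lemma lead_monX f n : f != 0 -> lead_mon (f ^+ n) = (lead_mon f *+ n)%MM.
Proof.
move=> f0; elim: n => [|n IHn].
  by rewrite expr0 /lead_mon lead_coef1 mlead1.
by rewrite exprS lead_monM ?expf_neq0// IHn mulmS.
Qed.

Lemma deg_exp f n : f != 0 -> (size (f ^+ n)).-1 = (n * (size f).-1)%N.
Proof.
move=> f0; elim: n => [|n IHn]; first by rewrite expr0 size_poly1.
by rewrite exprS deg_mul ?expf_neq0// IHn mulSn.
Qed.

(** One step of polynomial division. *)
Lemma lead_reduce f g b k : f != 0 -> g != 0 ->
  lead_mon f = (lead_mon g + b)%MM -> (size f).-1 = ((size g).-1 + k)%N ->
  lead_lt (f - term (lead_scal f / lead_scal g) b k * g) f.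
Proof.
move=> f0 g0 eq_mon eq_deg; set c := _ / _.
have c0 : c != 0 by rewrite mulf_neq0 ?invr_eq0 ?lead_scal_eq0.
have t0 : term c b k != 0 by rewrite -size_poly_gt0 size_term.
apply: lead_cancel => //.
- rewrite size_mul// size_term//.
  move: eq_deg f0 g0; rewrite -!size_poly_gt0.
  by case: (size f) (size g) => [|u] [|v] //= -> _ _; rewrite addnS addnC.
- by rewrite lead_monM// lead_mon_term// eq_mon addmC.
- by rewrite lead_scalM// lead_scal_term divfK// lead_scal_eq0.
Qed.

End LeadingTerms.

Arguments term {K s} c a n.
Arguments lead_mon {K s} f.
Arguments lead_scal {K s} f.
Arguments lead_lt {K s} g f.

(** * Facts from algebra *)

Lemma clear_denominators s m (C : 'M[rat]_(s, m)) :
  (forall i j, 0 <= C i j) ->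
  exists (D : nat) (N : 'M[nat]_(s, m)), (0 < D)%N /\
    forall i j, D%:R * C i j = (N i j)%:R.
Proof.
move=> C_ge0; pose den (x : 'I_s * 'I_m) := `|denq (C x.1 x.2)|%N.
pose D := (\prod_x den x)%N.
have dvD i j : (den (i, j) %| D)%N by rewrite /D (bigD1 (i, j))//= dvdn_mulr.
exists D, (\matrix_(i, j) (D %/ den (i, j) * `|numq (C i j)|)%N); split=> [|i j].
  by apply: prodn_gt0 => x; rewrite absz_gt0 denq_eq0.
rewrite mxE natrM -[in LHS](divnK (dvD i j)) natrM -mulrA; congr (_ * _).
have absE (z : int) : 0 <= z -> (`|z|%N%:R : rat) = z%:~R.
  by move=> z_ge0; rewrite natr_absz ger0_norm.
by rewrite !absE ?numq_ge0// numqE mulrC.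
Qed.

Lemma ideal_gen_is_ideal (A : comNzRingType) (X : set A) :
  is_ideal (ideal_gen X).
Proof.
split=> [J [[]]//|x y Ix Iy J JX|a x Ix J JX]; have [[_ JD JM] _] := JX.
  by apply: JD; [exact: Ix JX|exact: Iy JX].
by apply: JM; exact: Ix JX.
Qed.

Lemma ideal_exp_is_ideal (A : comNzRingType) (I : set A) n :
  is_ideal (ideal_exp I n).
Proof. by case: n => [|n]; [split|apply: ideal_gen_is_ideal]. Qed.

Lemma monomial_ideal (K : fieldType) s (I : set {mpoly K[s]}) f :
  is_ideal I -> (forall a, a \in msupp f -> I 'X_[a]) -> I f.
Proof.
move=> [I0 ID IM] If; rewrite (mpolyE f) big_seq.
by apply: (big_ind I) => // a af; rewrite -mul_mpolyC; apply: IM; apply: If.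
Qed.

Lemma fraction_numden (A : idomainType) (u : {fraction A}) :
  exists p q : A, q != 0 /\ u = tofrac p / tofrac q.
Proof.
elim/quotW: u => r; exists \n_r, \d_r; split; first exact: denom_ratioP.
have d0 : tofrac \d_r != 0 by rewrite tofrac_eq0 denom_ratioP.
apply: (mulIf d0); rewrite divfK//.
unlock FracField.tofrac; rewrite -[LHS]FracField.pi_mul.
apply/eqmodP => /=; rewrite /FracField.equivf /= /FracField.mulf.
by rewrite !numden_Ratio ?mulf_neq0 ?oner_neq0 ?denom_ratioP// !mulr1 mulrC.
Qed.

(** The condition says that [p / q] is almost integral; almost integral
    elements form a ring, so translating [p / q] by [t] preserves it, here with
    the same denominator [d]. *)
Lemma almost_multiple_shift (A : comNzRingType) (d p q t : A) :
  (forall n, exists e, d * p ^+ n = q ^+ n * e) ->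
  forall n, exists e, d * (p + t * q) ^+ n = q ^+ n * e.
Proof.
move=> Hn n; rewrite exprDn mulr_sumr.
apply: (big_ind (fun x => exists e, x = q ^+ n * e)) => [|_ _ [x ->] [y ->]|i _].
- by exists 0; rewrite mulr0.
- by exists (x + y); rewrite mulrDr.
have [e defe] := Hn (n - i)%N; have le_in : (i <= n)%N by rewrite -ltnS.
exists (e * t ^+ i *+ 'C(n, i)); rewrite !mulrnAr; congr (_ *+ _).
rewrite [LHS]mulrA defe exprMn (_ : q ^+ n = q ^+ (n - i) * q ^+ i).
  by rewrite [t ^+ i * _]mulrC mulrACA.
by rewrite -exprD subnK.
Qed.

(** An integral element [u = p / q] of degree [N] is almost integral: the ring
    generated by [u] is spanned by [1, ..., u^(N-1)], and [q^N] clears the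
    denominators of these powers, hence of all powers of [u]. *)
Lemma completely_integrally_closed_normal (A : idomainType) :
  (forall p q d : A, q != 0 -> d != 0 ->
    (forall n, exists e, d * p ^+ n = q ^+ n * e) -> exists e, p = q * e) ->
  normal_domain A.
Proof.
move=> cic u [P Pmonic Pu]; have [p [q [q0 defu]]] := fraction_numden _ u.
have q0F : tofrac q != 0 by rewrite tofrac_eq0.
suff [e defp] : exists e, p = q * e.
  by exists e; rewrite defu defp tofracM mulrAC divff// mul1r.
pose N := (size P).-1; apply: (cic p q (q ^+ N)) => //; first by rewrite expf_neq0.
suff uN n : exists e, tofrac (q ^+ N) * u ^+ n = tofrac e.
  move=> n; have [e defe] := uN n; exists e; apply/eqP; rewrite -tofrac_eq.
  rewrite !tofracM -defe defu expr_div_n !tofracXn mulrCA [_ / _]mulrC.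
  by rewrite mulVKf// expf_neq0.
elim/ltn_ind: n => n IHn; have [le_nN|lt_Nn] := leqP n N.
  exists (q ^+ (N - n) * p ^+ n); rewrite defu expr_div_n !(tofracM, tofracXn).
  rewrite -{1}(subnK le_nN) exprD -!mulrA; congr (_ * _).
  by rewrite mulrC divfK// expf_neq0.
have uE : u ^+ N = - \sum_(i < N) tofrac P`_i * u ^+ i.
  apply/eqP; rewrite -addr_eq0 addrC; move: Pu; rewrite /root horner_poly.
  have szP : size P = N.+1 by rewrite prednK// size_poly_gt0 monic_neq0.
  rewrite szP big_ord_recr /= -/(lead_coef P).
  by rewrite (monicP Pmonic) tofrac1 mul1r => ->.
rewrite -(subnK (ltnW lt_Nn)) exprD uE mulrN mulrN mulrA mulr_sumr.
have [e ->] : exists e, \sum_(i < N)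
    tofrac (q ^+ N) * u ^+ (n - N) * (tofrac P`_i * u ^+ i) = tofrac e.
  apply: (big_ind (fun v => exists e, v = tofrac e)) => [|_ _ [x ->] [y ->]|i _].
  - by exists 0; rewrite tofrac0.
  - by exists (x + y); rewrite tofracD.
  have [|e defe] := IHn (n - N + i)%N.
    by rewrite -{2}(subnK (ltnW lt_Nn)) ltn_add2l.
  by exists (P`_i * e); rewrite tofracM -defe exprD mulrCA -mulrA.
by exists (- e); rewrite tofracN.
Qed.

(** * The Rees algebra *)

Section ReesAlgebra.
Variables (R : realType) (K : fieldType) (s m : nat) (C : 'M[rat]_(s, m)).
Variables (D : nat) (N : 'M[nat]_(s, m)).
Hypothesis D_gt0 : (0 < D)%N.
Hypothesis DN : forall i j, D%:R * C i j = (N i j)%:R.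

Local Notation in_M := (in_monoid D N).
Local Notation Sz := {poly {mpoly K[s]}}.
Local Notation RA := (rees_algebra R K C).
Local Notation cone := (integral_simis_cone R C).
Implicit Types (a b : 'X_{1..s}) (n k : nat).

Lemma in_monoidP a n : in_M a n <->
  forall j, n%:R <= \sum_i (a i)%:R * (ratr (C i j) : R).
Proof.
have weightE j : (col_weight N a j)%:R =
    D%:R * \sum_i (a i)%:R * (ratr (C i j) : R).
  rewrite /col_weight natr_sum mulr_sumr; apply: eq_bigr => i _.
  rewrite natrM mulrCA; congr (_ * _).
  by rewrite -[LHS](ratr_nat R) -DN rmorphM /= ratr_nat.
by split=> Ma j; have := Ma j; rewrite -(ler_nat R) natrM weightE ler_pM2l ?ltr0n.
Qed.

Lemma covering_polyhedronP a n : (0 < n)%N ->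
  covering_polyhedron R C (\row_i ((a i)%:R / n%:R)) <-> in_M a n.
Proof.
move=> n_gt0; have n0 : 0 < n%:R :> R by rewrite ltr0n.
have prodE j : ((\row_i ((a i)%:R / n%:R)) *m map_mx ratr C) 0 j =
    (\sum_i (a i)%:R * (ratr (C i j) : R)) / n%:R.
  rewrite mxE mulr_suml; apply: eq_bigr => i _.
  by rewrite !mxE mulrAC.
split=> [[_ Qa]|/in_monoidP Ma].
  by apply/in_monoidP => j; have := Qa j; rewrite prodE mxE ler_pdivlMr// mul1r.
split=> [i|j]; first by rewrite !mxE divr_ge0 ?ler0n.
by rewrite prodE mxE ler_pdivlMr// mul1r.
Qed.

Lemma monomial_exponentD a b n k :
  monomial_exponent (a + b)%MM (n + k) =
  monomial_exponent a n + monomial_exponent b k.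
Proof.
rewrite /monomial_exponent add_row_mx; congr row_mx; apply/rowP => i.
  by rewrite !mxE mnmDE PoszD.
by rewrite !mxE PoszD.
Qed.

Lemma monomial_exponent_inj a b n k :
  monomial_exponent a n = monomial_exponent b k -> a = b /\ n = k.
Proof.
move=> /eq_row_mx[/rowP eq_ab /rowP/(_ 0)]; rewrite !mxE => -[->]; split=> //.
by apply/mnmP => i; have := eq_ab i; rewrite !mxE => -[].
Qed.

Lemma monomial_exponent_cone a n : cone (monomial_exponent a n) <-> in_M a n.
Proof.
have dotE j : dot (map_mx intr (monomial_exponent a n))
    (row_mx (map_mx ratr (col j C)^T) (const_mx (-1))) =
    \sum_i (a i)%:R * (ratr (C i j) : R) - n%:R.
  rewrite /dot big_split_ord /= big_ord1 map_row_mx !row_mxEr !mxE mulrN1.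
  congr (_ - _); apply: eq_bigr => i _.
  by rewrite !row_mxEl !mxE.
split=> [[_ Ca]|/in_monoidP Ma].
  by apply/in_monoidP => j; have := Ca j; rewrite dotE subr_ge0.
split=> [i|j]; last by rewrite dotE subr_ge0.
rewrite map_row_mx; case: (splitP i) => k ik.
  have -> : i = lshift 1 k by apply/val_inj.
  by rewrite row_mxEl !mxE ler0n.
have -> : i = rshift s k by apply/val_inj.
by rewrite row_mxEr !mxE ler0n.
Qed.

Lemma cone_monomial_exponent v : cone v ->
  exists a n, v = monomial_exponent a n.
Proof.
move=> [v_ge0 _]; have {}v_ge0 i : 0 <= v 0 i.
  by have := v_ge0 i; rewrite !mxE ler0z.
exists [multinom `|(v 0 (lshift 1 i))%R|%N | i < s], `|(v 0 (rshift s 0))%R|%N.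
apply/rowP => i; rewrite /monomial_exponent; case: (splitP i) => k ik.
  have -> : i = lshift 1 k by apply/val_inj.
  by rewrite row_mxEl !mxE mnmE gez0_abs.
have -> : i = rshift s k by apply/val_inj.
by rewrite row_mxEr !mxE gez0_abs ?ord1.
Qed.

(** An integral point that is not in the Hilbert basis is a sum of two nonzero
    ones, both of smaller total degree as the cone is in the positive orthant. *)
Lemma nat_span_hilbert_basis v : nat_span (hilbert_basis R C) v <-> cone v.
Proof.
have cone0 : cone 0.
  have -> : 0 = monomial_exponent (0%MM : 'X_{1..s}) 0.
    by rewrite -row_mx0; congr row_mx; apply/rowP => i; rewrite !mxE ?mnm0E.
  by apply/monomial_exponent_cone; apply: in_monoid0.
split=> [Hv|].
  apply: (Hv cone); split=> [|u []//]; split=> // x y xC yC.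
  have [a [n defx]] := cone_monomial_exponent x xC.
  have [b [k defy]] := cone_monomial_exponent y yC.
  move: xC yC; rewrite defx defy -monomial_exponentD !monomial_exponent_cone.
  exact: in_monoidD.
move=> vC M [[M0 MD] HM]; have [a [n defv]] := cone_monomial_exponent v vC.
have [w] := ubnP (mdeg a + n).
elim: w a n v defv vC => // w IHw a n v defv vC le_w.
have [->//|v0] := eqVneq v 0.
have [Hv|nHv] := pselect (hilbert_basis R C v); first exact: HM.
have [x [y [xC x0 yC y0 defxy]]] : exists x y : 'rV[int]_(s + 1),
    [/\ cone x, x != 0, cone y, y != 0 & v = x + y].
  by apply: contrapT => nxy; apply: nHv.
have [b [k defx]] := cone_monomial_exponent x xC.
have [c [l defy]] := cone_monomial_exponent y yC.
have pos (u : 'rV[int]_(s + 1)) d e :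
  u != 0 -> u = monomial_exponent d e -> (0 < mdeg d + e)%N.
  rewrite lt0n addn_eq0 mdeg_eq0 => u0 defu.
  apply: contra u0 => /andP[/eqP d0 /eqP e0].
  have : monomial_exponent d e = monomial_exponent d e + monomial_exponent d e.
    by rewrite -monomial_exponentD d0 e0 addm0.
  by rewrite -defu => /eqP; rewrite -subr_eq0 opprD addNKr oppr_eq0.
have b0 := pos _ _ _ x0 defx; have c0 := pos _ _ _ y0 defy.
have [defa defn] : a = (b + c)%MM /\ n = (k + l)%N.
  by apply: monomial_exponent_inj; rewrite -defv defxy defx defy monomial_exponentD.
rewrite defa defn mdegD in le_w; rewrite defxy.
by apply: MD; [apply: (IHw b k)|apply: (IHw c l)] => //; lia.
Qed.

(** Polynomials supported on the exponents of degree [n] form an ideal, because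
    the monoid contains [N^s * 0]. *)
Lemma filtrationP n (f : {mpoly K[s]}) :
  filtration R K C n f <-> forall a, a \in msupp f -> in_M a n.
Proof.
split=> [|Mf]; last first.
  apply: monomial_ideal; first exact: filtration_ideal.
  move=> a /Mf; case: n {Mf} => // n Ma J [_]; apply.
  by exists a => //; apply/covering_polyhedronP.
case: n => [_ a _|n If]; first exact: in_monoid0.
apply: (If [set f | forall a, a \in msupp f -> in_M a n.+1]); split.
  split=> [a|x y Mx My a /msuppD_le|x y My a /msuppM_le].
  - by rewrite msupp0.
  - by rewrite mem_cat => /orP[/Mx|/My].
  - case/allpairsP => -[b c] /= [_ /My Mc ->].
    by rewrite -[n.+1]add0n; apply: in_monoidD Mc; apply: in_monoid0.
move=> _ [b /covering_polyhedronP Mb ->] a /=.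
by rewrite msuppX inE => /eqP->; apply: Mb.
Qed.

Lemma rees_term c a n : in_M a n -> rees R K C (term c a n).
Proof.
move=> Ma k; rewrite coef_term; case: eqP => [->|_].
  by apply/filtrationP => b /msuppZ_le; rewrite msuppX inE => /eqP->.
by have [] := @filtration_ideal R K s m C k.
Qed.

Lemma rees_lead (f : Sz) : f != 0 -> rees R K C f ->
  in_M (lead_mon f) (size f).-1.
Proof.
move=> f0 /(_ (size f).-1)/filtrationP; apply; apply: mlead_supp.
by rewrite lead_coef_eq0.
Qed.

Lemma rees_term_sum (P : Sz -> Prop) : P 0 ->
  (forall f g, P f -> P g -> P (f + g)) ->
  (forall c a n, in_M a n -> P (term c a n)) ->
  forall f, rees R K C f -> P f.
Proof.
move=> P0 PD PT f Rf; rewrite -[f]coefK poly_def.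
apply: (big_ind P) => // i _; have /filtrationP := Rf i.
rewrite {2}(mpolyE f`_i) scaler_suml big_seq => Mi.
apply: (big_ind P) => // a /Mi Ma.
by rewrite -mul_polyC -termE; apply: PT.
Qed.

Lemma rees_eq_semigroup_ring :
  rees R K C = semigroup_ring K (nat_span (hilbert_basis R C)).
Proof.
apply/seteqP; split=> [f Rf B [[Bc BD BM] BX]|f].
  apply: (rees_term_sum B) Rf => // [|c a n Ma].
    by have := Bc 0; rewrite rmorph0.
  apply: BM => //; apply: BX; exists a, n; split=> //.
  by apply/nat_span_hilbert_basis/monomial_exponent_cone.
apply; split; first split=> [c|x y|x y].
- by apply/rees_predP; apply: scalar_rees.
- by move=> /rees_predP Rx /rees_predP Ry; apply/rees_predP; apply: rpredD.
- by move=> /rees_predP Rx /rees_predP Ry; apply/rees_predP; apply: rpredM.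
move=> _ [a [n [/nat_span_hilbert_basis/monomial_exponent_cone Ma ->]]].
have := rees_term 1 a n Ma.
by rewrite /term rmorph1 mul1r.
Qed.

Lemma rees_termP c a n : in_M a n -> exists t : RA, t = term c a n :> Sz.
Proof. by move=> /(rees_term c)/rees_predP Rt; exists (ReesAlgebra Rt). Qed.

Lemma rees_valB (x y : RA) : rees_val (x - y) = rees_val x - rees_val y.
Proof. exact: (rmorphB val). Qed.
Lemma rees_valD (x y : RA) : rees_val (x + y) = rees_val x + rees_val y.
Proof. exact: (rmorphD val). Qed.
Lemma rees_valM (x y : RA) : rees_val (x * y) = rees_val x * rees_val y.
Proof. exact: (rmorphM val). Qed.
Lemma rees_valX (x : RA) n : rees_val (x ^+ n) = rees_val x ^+ n.
Proof. exact: (rmorphXn val). Qed.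
Lemma rees_val_eq0 (x : RA) : (rees_val x == 0) = (x == 0).
Proof. by rewrite -val_eqE. Qed.
Lemma rees_val_inj (x y : RA) : x = y :> Sz -> x = y.
Proof. exact: val_inj. Qed.
Lemma rees_val_lead (x : RA) : x != 0 -> in_M (lead_mon x) (size x).-1.
Proof.
move=> x0; apply: rees_lead; rewrite ?rees_val_eq0//.
by apply/rees_predP/rees_valP.
Qed.

(** The point of asking [b] and [k] to be in the monoid is that the quotient of
    the leading terms is then itself in the Rees algebra. *)
Lemma rees_divide (f g : RA) b k : f != 0 -> g != 0 -> in_M b k ->
  lead_mon f = (lead_mon g + b)%MM -> (size f).-1 = ((size g).-1 + k)%N ->
  exists t : RA, lead_lt (f - t * g) f.
Proof.
move=> f0 g0 Mb eq_mon eq_deg.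
have [t deft] := rees_termP (lead_scal f / lead_scal g) b k Mb.
exists t; rewrite rees_valB rees_valM deft.
by apply: lead_reduce; rewrite ?rees_val_eq0.
Qed.

(** Generators of an ideal are elements whose leading exponents dominate, in the
    order of the monoid, those of all its elements: the remainder of a division
    by them has a smaller leading term, and is still in the ideal. *)
Lemma rees_noetherian : noetherian RA.
Proof.
move=> I [I0 ID IM].
pose e (f : RA) := (lead_mon f, (size f).-1).
have [fs [fsI fsP]] := @dickson_monoid s m D N RA e [set f | I f /\ f != 0]
  (fun f If => rees_val_lead f (proj2 If)).
exists fs; apply/seteqP; split=> f; last first.
  by apply; split=> // g /fsI[].
have [J0 JD JM] := ideal_gen_is_ideal _ [set` fs].
have [F defF] : exists F, F = f :> Sz by exists f.
elim/(@lead_ind K s): F f defF => F IHF f defF If.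
have [->//|f0] := eqVneq f 0.
have [g [b [k [gfs Mb eq_mon eq_deg]]]] := fsP f (conj If f0).
have [Ig g0] := fsI g gfs.
have [t lt_f] := rees_divide f g b k f0 g0 Mb eq_mon eq_deg.
rewrite -(subrK (t * g) f); apply: JD; last by apply: JM => J [_]; apply.
apply: (IHF (f - t * g)) => //; first by rewrite defF.
by apply: ID => //; rewrite -mulNr; apply: IM.
Qed.

(** Long division of [p] by [q] never gets stuck: the hypothesis forces the
    leading term of [q] to divide that of [p] in the Rees algebra, and it holds
    again for the remainder. *)
Lemma rees_completely_integrally_closed (p q d : RA) : q != 0 -> d != 0 ->
  (forall n, exists e, d * p ^+ n = q ^+ n * e) -> exists e, p = q * e.
Proof.
move=> q0 d0; have [F defF] : exists F, F = p :> Sz by exists p.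
elim/(@lead_ind K s): F p defF => F IHF p defF Hn.
have [->|p0] := eqVneq p 0; first by exists 0; rewrite mulr0.
have [|b [k [Mb eq_mon eq_deg]]] := @in_monoid_asymptotic s m D N
  (lead_mon d, (size d).-1) (lead_mon p, (size p).-1)
  (lead_mon q, (size q).-1).
  move=> n; have [e defe] := Hn n.
  have e0 : e != 0.
    apply/eqP => e0; have /eqP := defe.
    by rewrite e0 mulr0 mulf_eq0 (negPf d0) expf_eq0 (negPf p0) andbF.
  exists (lead_mon e), (size e).-1; split => /=; first exact: rees_val_lead.
    have : lead_mon (d * p ^+ n : RA) = lead_mon (q ^+ n * e : RA).
      by rewrite defe.
    rewrite !rees_valM !rees_valX !lead_monM ?expf_neq0 ?rees_val_eq0//.
    by rewrite !lead_monX ?rees_val_eq0.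
  have : (size (d * p ^+ n : RA)%R).-1 = (size (q ^+ n * e : RA)%R).-1.
    by rewrite defe.
  rewrite !rees_valM !rees_valX !deg_mul ?expf_neq0 ?rees_val_eq0//.
  by rewrite !deg_exp ?rees_val_eq0.
have [t lt_p] := rees_divide p q b k p0 q0 Mb eq_mon eq_deg.
rewrite -defF in lt_p.
have [|e defe] := IHF _ lt_p (p - t * q) erefl.
  by rewrite -mulNr; apply: (almost_multiple_shift _ d p q (- t) Hn).
by exists (e + t); rewrite mulrDr -defe [q * t]mulrC subrK.
Qed.

Lemma rees_finitely_generated : finitely_generated_algebra (rees_scalar R K C).
Proof.
have [hs [Mhs hsP]] := monoid_finitely_generated s m D N.
(* The default value 0 is never taken on exponents of the monoid. *)
pose gen a n : RA := insubd 0 (term 1 a n).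
have genE a n : in_M a n -> gen a n = term 1 a n :> Sz.
  by move=> /(rees_term 1)/rees_predP Rt; rewrite /gen val_insubd Rt.
exists [seq gen h.1 h.2 | h <- hs].
apply/seteqP; split=> // f _ B [[Bc BD BM] BX].
have Bgen a n : in_M a n -> B (gen a n).
  move=> /hsP; suff : nat_comb hs a n -> in_M a n /\ B (gen a n).
    by move=> /[apply] -[].
  apply: (nat_comb_ind s hs (fun a n => in_M a n /\ B (gen a n)))
    => [|h b k hhs [Mb Bb]].
    split; first exact: in_monoid0.
    have -> : gen 0%MM 0%N = 1; last by rewrite -(rmorph1 (rees_scalar R K C)).
    apply: rees_val_inj; rewrite genE; last exact: in_monoid0.
    by rewrite /term rmorph1 mul1r mpolyX0 expr0 mulr1.
  have Mh := Mhs h hhs; have Mhb := in_monoidD s m D N _ _ _ _ Mh Mb.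
  split=> //; have -> : gen (h.1 + b)%MM (h.2 + k)%N = gen h.1 h.2 * gen b k.
    apply: rees_val_inj; rewrite rees_valM !genE// /term rmorph1 !mul1r.
    by rewrite mpolyXD polyCM exprD mulrACA.
  by apply: BM => //; apply: BX; apply/mapP; exists h.
have [g -> Bg] : exists2 g, f = g & B g; last by [].
suff [g eq_g Bg] : exists2 g : RA, f = g :> Sz & B g.
  by exists g => //; apply: rees_val_inj.
apply: (rees_term_sum (fun F => exists2 g : RA, F = g & B g)).
- by exists 0; [|rewrite -(rmorph0 (rees_scalar R K C))].
- move=> _ _ [x -> Bx] [y -> By]; exists (x + y); first by rewrite rees_valD.
  exact: BD.
- move=> c a n Ma; exists (rees_scalar R K C c * gen a n).
    by rewrite rees_valM genE// /term rmorph1 mul1r.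
  by apply: BM; [apply: Bc|apply: Bgen].
by apply/rees_predP/rees_valP.
Qed.

(** Each [I_n] is generated by monomials, for which [veronese_split] provides
    the factorization. *)
Lemma filtration_veronese : exists p : nat, (0 < p)%N /\
  forall n : nat, ideal_exp (filtration R K C p) n = filtration R K C (n * p)%N.
Proof.
have [p [p_gt0 pP]] := veronese_split s m D N; exists p; split=> // n.
apply/seteqP; split.
  elim: n => [|n IHn] f //= If.
  apply: (If (filtration R K C (n.+1 * p))); split; first exact: filtration_ideal.
  by move=> _ [x [y [Ix /IHn Iy ->]]]; rewrite mulSn; apply: filtrationM.
move=> f /filtrationP Mf; apply: monomial_ideal; first exact: ideal_exp_is_ideal.
move=> a /Mf {f Mf}; elim: n a => [//|n IHn] a Ma.
have [b [c [Mb Mc ->]]] := pP a n Ma.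
move=> J [_]; apply; exists 'X_[b], 'X_[c]; split; last by rewrite mpolyXD.
  by apply/filtrationP => d; rewrite msuppX inE => /eqP->.
exact: IHn.
Qed.

End ReesAlgebra.

Theorem theorem3p15 (R : realType) (K : fieldType) (s m : nat)
    (C : 'M[rat]_(s, m))
    (C_ge0 : forall (i : 'I_s) (j : 'I_m), 0 <= C i j)
    (C_col_neq0 : forall j : 'I_m, col j C != 0) :
  [/\ rees R K C = semigroup_ring K (nat_span (hilbert_basis R C)),
      [/\ noetherian (rees_algebra R K C),
          normal_domain (rees_algebra R K C)
        & finitely_generated_algebra (rees_scalar R K C)]
    & exists p : nat, (0 < p)%N /\
        forall n : nat, (0 < n)%N ->
          ideal_exp (filtration R K C p) n = filtration R K C (n * p)%N].
Proof.
have [D [N [D_gt0 DN]]] := clear_denominators s m C C_ge0.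
split.
- exact: rees_eq_semigroup_ring D_gt0 DN.
- split.
  + exact: rees_noetherian D_gt0 DN.
  + apply: completely_integrally_closed_normal => p q d.
    exact: (@rees_completely_integrally_closed R K s m C D N).
  + exact: rees_finitely_generated D_gt0 DN.
- have [p [p_gt0 pP]] := @filtration_veronese R K s m C D N D_gt0 DN.
  by exists p.
Qed.
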